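(* Let $\lambda\in(0,\frac12)$ be any fixed constant. Then for each $\sigma\in[\sigma_\lambda,1)$, the constants $$\mu_1^{\lambda}=\frac{\varphi_\lambda''(\sigma z^\lambda)\,[\varphi_\lambda(-z^\lambda)+\varphi_\lambda(z^\lambda)]}{\varphi_\lambda(-\sigma z^\lambda)\varphi_\lambda''(\sigma z^\lambda)-\varphi_\lambda(\sigma z^\lambda)\varphi_\lambda''(-\sigma z^\lambda)},\qquad \mu_2^{\lambda}=\frac{\varphi_\lambda''(-\sigma z^\lambda)\,[\varphi_\lambda(-z^\lambda)+\varphi_\lambda(z^\lambda)]}{\varphi_\lambda(\sigma z^\lambda)\varphi_\lambda''(-\sigma z^\lambda)-\varphi_\lambda(-\sigma z^\lambda)\varphi_\lambda''(\sigma z^\lambda)}$$ satisfy $\mu_1^\lambda>0$ and $\mu_2^\lambda\ge 0$, and the function $$H_{\lambda,\sigma}(x):=\begin{cases}\mu_1^\lambda\varphi_\lambda(x)+\mu_2^\lambda\varphi_\lambda(-x), & x\le-\sigma z^\lambda,\\ \varphi_\lambda\!\left(\frac{x}{\sigma}\right)+\varphi_\lambda\!\left(-\frac{x}{\sigma}\right), & -\sigma z^\lambda<x<\sigma z^\lambda,\\ \mu_2^\lambda\varphi_\lambda(x)+\mu_1^\lambda\varphi_\lambda(-x), & x\ge\sigma z^\lambda,\end{cases}$$ is a positive $C^2$ solution on $\mathbb{R}$ of the ODE $$(y'')^{+}-\sigma^{2}(y'')^{-}+xy'+2\lambda y=0.$$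
   Context: For real $a$, $a^{+}=\max\{0,a\}$ and $a^{-}=(-a)^{+}$. For $\lambda\in(0,\frac12)$ and $x\in\mathbb{R}$, $$\varphi_\lambda(x):=\int_0^{+\infty}y^{-2\lambda}\exp\left\{-\frac{(y-x)^2}{2}\right\}dy .$$ Primes denote derivatives in $x$. For each $\lambda\in(0,\frac12)$, $x_1^\lambda<0$ denotes the unique negative number with $\varphi_\lambda''(x_1^\lambda)=0$, $z^\lambda>0$ denotes the unique positive number with $\varphi_\lambda''(z^\lambda)+\varphi_\lambda''(-z^\lambda)=0$, and $\sigma_\lambda:=-x_1^\lambda/z^\lambda$. (These numbers exist and are unique, and $-x_1^\lambda<z^\lambda$, so $\sigma_\lambda\in(0,1)$.) *)

(* Defs.v *)
From HB Require Import structures.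
From mathcomp Require Import all_boot all_order all_algebra.
From mathcomp Require Import all_classical all_reals all_analysis.

Set Implicit Arguments.
Unset Strict Implicit.
Unset Printing Implicit Defensive.

Import Order.TTheory GRing.Theory Num.Theory.
Import numFieldNormedType.Exports.

Local Open Scope classical_set_scope.
Local Open Scope ring_scope.

(* In [ring_scope] these notations otherwise denote derivatives of polynomials. *)
Local Notation "f ^` ()" := (derive1 f) : ring_scope.
Local Notation "f ^` ( n )" := (derive1n n f) : ring_scope.

Section Defs.
Context {R : realType}.
Implicit Types (lambda sigma x : R) (f y : R -> R).

Definition phi lambda x : R :=
  \int[lebesgue_measure]_(y in `]0, +oo[)
    (y `^ (- (2 * lambda)) * expR (- ((y - x) ^+ 2 / 2))).

(* [x1] and [z] are definite descriptions: for 0 < lambda < 1/2 each of the two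
   sets below is a singleton, and the default value 0 of [xget] is not used. *)
Definition x1 lambda : R :=
  xget 0 [set x : R | x < 0 /\ (phi lambda)^`(2) x = 0].

Definition z lambda : R :=
  xget 0 [set x : R | 0 < x /\ (phi lambda)^`(2) x + (phi lambda)^`(2) (- x) = 0].

Definition sigma_low lambda : R := - x1 lambda / z lambda.

Definition mu1 lambda sigma : R :=
  let p := phi lambda in let p'' := p^`(2) in let a := z lambda in
  p'' (sigma * a) * (p (- a) + p a) /
  (p (- (sigma * a)) * p'' (sigma * a) - p (sigma * a) * p'' (- (sigma * a))).

Definition mu2 lambda sigma : R :=
  let p := phi lambda in let p'' := p^`(2) in let a := z lambda in
  p'' (- (sigma * a)) * (p (- a) + p a) /
  (p (sigma * a) * p'' (- (sigma * a)) - p (- (sigma * a)) * p'' (sigma * a)).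

Definition H lambda sigma x : R :=
  if x <= - (sigma * z lambda) then
    mu1 lambda sigma * phi lambda x + mu2 lambda sigma * phi lambda (- x)
  else if x < sigma * z lambda then
    phi lambda (x / sigma) + phi lambda (- (x / sigma))
  else
    mu2 lambda sigma * phi lambda x + mu1 lambda sigma * phi lambda (- x).

(* The differentiability clauses are needed because [f^`()] is a total function,
   with unspecified values where [f] is not differentiable. *)
Definition C2 f : Prop :=
  [/\ forall x, derivable f x 1,
      forall x, derivable f^`() x 1
    & continuous f^`(2)].

Definition ode_solution lambda sigma y : Prop :=
  forall x, (y^`(2))^\+ x - sigma ^+ 2 * (y^`(2))^\- x
            + x * y^`() x + 2 * lambda * y x = 0.

End Defs.

(* Main.v *)
(* With a = 2 lambda, phi(x) = e^(-x^2/2) m_0(x) where m_k(x) is the integral over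
   (0, +oo) of y^(k-a) e^(xy - y^2/2).  Differentiation under the integral gives
   m_k' = m_(k+1), and integration by parts gives m_2 = x m_1 + (1-a) m_0, so phi solves
   phi'' + x phi' + a phi = 0 and phi' > 0 on (-oo, 0].
   Multiplying by the integrating factor E = e^(x^2/2), (E phi'')' = -(1+a) E phi', so
   E phi'' decreases on (-oo, 0]; for the even solution h(x) = phi(x) + phi(-x) one has
   (E h')' = -a E h < 0, hence h' < 0 on (0, +oo) and E h'' increases there without bound.
   This yields x1 and z with the signs of phi'' and h'' around them.  At s = sigma z, the
   constants mu1 and mu2 make the value match and the second derivative vanish on both
   sides, and the equation then forces the slopes to agree.  Finally
   mu2 phi''(x) + mu1 phi''(-x) >= 0 for x >= s because phi''(x) / phi''(-x) is increasing:
   its Wronskian is a positive multiple of that of phi(x) and phi(-x). *)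
Require Import Defs.
From HB Require Import structures.
From mathcomp Require Import all_boot all_order all_algebra.
From mathcomp Require Import ring lra.
From mathcomp Require Import all_classical all_reals all_analysis.
From mathcomp Require Import measurable_realfun lebesgue_integral_under.

Set Implicit Arguments.
Unset Strict Implicit.
Unset Printing Implicit Defensive.
Import Order.TTheory GRing.Theory Num.Theory.
Import numFieldNormedType.Exports.
Local Open Scope classical_set_scope.
Local Open Scope ring_scope.
Local Notation "f ^` ()" := (derive1 f) : ring_scope.
Local Notation "f ^` ( n )" := (derive1n n f) : ring_scope.

(** * Derivation rules in a form that matches explicit abstractions *)

Section pointwise_derivation_rules.
Context {R : realType}.
Implicit Types (f g : R -> R) (x a b : R).

Lemma is_derive_fctD f g x a b : is_derive x 1 f a -> is_derive x 1 g b ->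
  is_derive x 1 (fun t => f t + g t) (a + b).
Proof. exact: is_deriveD. Qed.

Lemma is_derive_fctB f g x a b : is_derive x 1 f a -> is_derive x 1 g b ->
  is_derive x 1 (fun t => f t - g t) (a - b).
Proof. exact: is_deriveB. Qed.

Lemma is_derive_fctN f x a : is_derive x 1 f a ->
  is_derive x 1 (fun t => - f t) (- a).
Proof. exact: is_deriveN. Qed.

Lemma is_derive_fctM f g x a b : is_derive x 1 f a -> is_derive x 1 g b ->
  is_derive x 1 (fun t => f t * g t) (a * g x + f x * b).
Proof.
by move=> fa gb; apply: is_derive_eq (is_deriveM fa gb) _; rewrite addrC [g x *: a]mulrC.
Qed.

Lemma is_derive_fctZ (k : R) f x a : is_derive x 1 f a ->
  is_derive x 1 (fun t => k * f t) (k * a).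
Proof. exact: is_deriveZ. Qed.

Lemma is_derive_fct_comp f g x a b : is_derive (g x) 1 f a ->
  is_derive x 1 g b -> is_derive x 1 (fun t => f (g t)) (a * b).
Proof. exact: is_derive1_comp. Qed.

Lemma is_derive_fct_expR g x b : is_derive x 1 g b ->
  is_derive x 1 (fun t => expR (g t)) (expR (g x) * b).
Proof. exact: is_derive_fct_comp. Qed.

Lemma is_derive_fct_opp f x a : is_derive (- x) 1 f a ->
  is_derive x 1 (fun t => f (- t)) (- a).
Proof.
by move=> /is_derive_fct_comp/(_ (is_deriveNid _ _)); rewrite mulrN1.
Qed.

Lemma is_derive_half_sqr x : is_derive x 1 (fun t : R => t ^+ 2 / 2) x.
Proof.
have : is_derive x 1 (fun t : R => 2^-1 * (t * t)) (2^-1 * (1 * x + x * 1)).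
  by apply: is_derive_fctZ; apply: is_derive_fctM.
rewrite (_ : 2^-1 * (1 * x + x * 1) = x); last by field.
by under eq_fun do rewrite mulrC.
Qed.

Lemma is_derive_continuous f x a : is_derive x 1 f a -> {for x, continuous f}.
Proof. by case=> /derivable1_diffP/differentiable_continuous. Qed.

End pointwise_derivation_rules.

(** * An improper fundamental theorem of calculus *)

Section FTC.
Context {R : realType}.
Notation mu := (@lebesgue_measure R).
Implicit Types f F : R -> R.

Lemma measurable_fun_continuous_oy f (c : R) :
  (forall x, c < x -> {for x, continuous f}) -> measurable_fun `]c, +oo[ f.
Proof.
move=> cf; apply: subspace_continuous_measurable_fun => //.
apply: continuous_in_subspaceT => x; rewrite inE/= in_itv/= andbT; exact: cf.
Qed.

(** Exhausting the open half-line by the closed ones starting at c + 1/(n+1) reduces this to the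
    closed case. A right limit of [F] at [c] replaces a value because the integrands below may blow
    up like y^(-a) at 0. *)
Lemma ge0_FTC_oy f F (c l r : R) :
  (forall x, c < x -> 0 <= f x) ->
  (forall x, c < x -> {for x, continuous f}) ->
  (forall x, c < x -> is_derive x 1 F (f x)) ->
  F x @[x --> c^'+] --> r -> F x @[x --> +oo] --> l ->
  (\int[mu]_(x in `]c, +oo[) (f x)%:E)%E = (l - r)%:E.
Proof.
move=> f0 cf dF Fr Fl; rewrite (itvoyEbigcup c).
pose e (n : nat) : R := c + n.+1%:R^-1.
have ce n : c < e n by rewrite /e ltrDl invr_gt0.
have mf n : measurable_fun `[e n, +oo[ (fun x => (f x)%:E).
  apply/measurable_EFinP; apply: measurable_funS (measurable_fun_continuous_oy cf) => //.
  by apply: subset_itv => //; rewrite bnd_simp ce.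
have cvgA : (\int[mu]_(x in `[e n, +oo[) (f x)%:E)%E @[n --> \oo] -->
    (\int[mu]_(x in \bigcup_n `[e n, +oo[%classic) (f x)%:E)%E.
  apply: ge0_nondecreasing_set_cvg_integral => //.
  - move=> m n mn; apply/subsetPset; apply: subset_itv => //; rewrite bnd_simp.
    by rewrite /e lerD2l lef_pV2 ?posrE// ler_nat.
  - move=> n x /=; rewrite in_itv/= andbT => enx.
    by rewrite lee_fin f0// (lt_le_trans (ce n)).
apply: (cvg_unique _ cvgA) => //=.
have E n : (\int[mu]_(x in `[e n, +oo[) (f x)%:E)%E = (l - F (e n))%:E.
  rewrite EFinB; apply: ge0_continuous_FTC2y => //.
  - by move=> x enx; apply/f0/(lt_le_trans (ce n)).
  - apply/continuous_within_itvcyP; split.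
      by move=> x; rewrite in_itv/= andbT => enx; apply/cf/(lt_trans (ce n)).
    by apply: cvg_at_right_filter; exact: cf.
  - by move=> x enx; have [] := dF x (lt_trans (ce n) enx).
  - apply: cvg_at_right_filter.
    by apply: differentiable_continuous; apply/derivable1_diffP; have [] := dF _ (ce n).
  - move=> x; rewrite in_itv/= andbT => enx.
    by rewrite derive1E; have [] := dF x (lt_trans (ce n) enx).
rewrite (_ : (fun n => _) = (fun n => (l - F (e n))%:E)); last exact/funext.
apply: cvg_EFin; first by apply: nearW.
apply: cvgB; first exact: cvg_cst.
move/cvg_at_rightP : Fr; apply; split => //.
rewrite -[X in _ --> X]addr0; apply: cvgD; first exact: cvg_cst.
exact: cvg_harmonic.
Qed.

End FTC.

(** * Moments of the kernel *)

(** If the integral were 0, [f] would vanish almost everywhere on [D], so [D] would be null. *)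
Lemma Rintegral_gt0 d (T : measurableType d) (R : realType)
    (mu : {measure set T -> \bar R}) (D : set T) (f : T -> R) :
  measurable D -> (0 < mu D)%E -> mu.-integrable D (EFin \o f) ->
  (forall x, D x -> 0 < f x) -> 0 < \int[mu]_(x in D) f x.
Proof.
move=> mD muD intf f0; have mf := measurable_int mu intf.
rewrite lt_neqAle Rintegral_ge0 ?andbT; last by move=> x /f0/ltW.
apply/negP => /eqP If0.
suff : ae_eq mu D (EFin \o f) (cst 0%E).
  move=> -[N [mN N0 DN]]; move: muD; apply/negP; rewrite -leNgt -[leRHS]N0.
  apply: le_measure; rewrite ?inE// => x Dx; apply: DN => /(_ Dx)/= [] /eqP.
  by rewrite gt_eqF// f0.
apply/(ae_eq_integral_abs mu mD mf).
rewrite (eq_integral (EFin \o f)) => [|x /[!inE] Dx]; last first.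
  by rewrite /= ger0_norm// ltW// f0.
by rewrite -[LHS]fineK; [rewrite -[X in X%:E]If0|exact: integrable_fin_num].
Qed.

Section kernel.
Context {R : realType} (a : R) (a_gt0 : 0 < a) (a_lt1 : a < 1).
Notation mu := (@lebesgue_measure R).
Implicit Types (x y : R) (k : nat).

(** The power y^(k - a) is split so that differentiation in [x] simply raises the natural exponent
    [k]. *)
Definition moment_kernel k x y := y `^ (- a) * (y ^+ k * expR (x * y - y ^+ 2 / 2)).
Local Notation w := moment_kernel.

Definition moment k x := \int[mu]_(y in `]0, +oo[) w k x y.
Local Notation m := moment.

(* An integrable majorant of every [w k x] with an explicit primitive: since
   [y `^ (1 - a) <= 1 + y], the exponential factor dominates [expR (- y - 1)]. *)
Definition dominator y := y `^ (- a) * expR (- y `^ (1 - a)).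

Lemma moment_kernel_gt0 k x y : 0 < y -> 0 < w k x y.
Proof. by move=> y0; rewrite !mulr_gt0 ?powR_gt0 ?expR_gt0 ?exprn_gt0. Qed.

Lemma dominator_ge0 y : 0 <= dominator y.
Proof. by rewrite mulr_ge0 ?powR_ge0 ?expR_ge0. Qed.

Lemma continuous_powR (r y : R) : 0 < y -> {for y, continuous (@powR R ^~ r)}.
Proof.
move=> y0; apply: differentiable_continuous; apply/derivable1_diffP.
by have [] := is_derive1_powR r y0.
Qed.

Lemma continuous_moment_kernel k x y : 0 < y -> {for y, continuous (w k x)}.
Proof.
move=> y0; apply: cvgM; first exact: continuous_powR.
apply: cvgM; first exact: exprn_continuous.
apply: continuous_comp; last exact: continuous_expR.
apply: cvgB; first by apply: cvgM; [exact: cvg_cst|exact: cvg_id].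
by apply: cvgM; [exact: exprn_continuous|exact: cvg_cst].
Qed.

Lemma continuous_dominator y : 0 < y -> {for y, continuous dominator}.
Proof.
move=> y0; apply: cvgM; first exact: continuous_powR.
apply: continuous_comp; last exact: continuous_expR.
by apply: cvgN; exact: continuous_powR.
Qed.

Lemma powR_le1D y : 0 < y -> y `^ (1 - a) <= 1 + y.
Proof.
move=> y0; have [y1|/ltW y1] := leP y 1.
  rewrite (@le_trans _ _ 1) ?lerDl ?(ltW y0)//.
  rewrite -[leRHS](powRr0 y); apply: ger_powR; first by rewrite y0.
  by rewrite subr_ge0 ltW.
rewrite (@le_trans _ _ y) ?lerDr// -[leRHS]powRr1 ?(ltW y0)//.
by apply: ler_powR => //; rewrite gerBl ltW.
Qed.

(** Bound y^k by e^(k y). Then (k + M + 1 - y)^2 >= 0 gives (k + M) y - y^2/2 <= (k + M + 1)^2/2 -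
    y, and - y <= 1 - y^(1 - a). *)
Lemma moment_kernel_le k (M x y : R) : `|x| <= M -> 0 < y ->
  w k x y <= expR ((k%:R + M + 1) ^+ 2 / 2 + 1) * dominator y.
Proof.
move=> xM y0; rewrite [leRHS]mulrCA ler_pM2l ?powR_gt0// -expRD.
apply: (@le_trans _ _ (expR (k%:R * y) * expR (x * y - y ^+ 2 / 2))).
  rewrite ler_wpM2r ?expR_ge0// expRM_natl lerXn2r ?nnegrE ?expR_ge0 ?ltW//.
  by rewrite (lt_le_trans _ (expR_ge1Dx _))// ltrDr.
rewrite -expRD ler_expR.
have := powR_le1D y0; move: (y `^ _) => p py.
have xy : x * y <= M * y by rewrite ler_pM2r// (le_trans (ler_norm _)).
have := sqr_ge0 (k%:R + M + 1 - y).
by move: (k%:R) => K; nra.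
Qed.

Let onema_gt0 : 0 < 1 - a. Proof. by rewrite subr_gt0. Qed.

Definition dominator_primitive y := - (1 - a)^-1 * expR (- y `^ (1 - a)).

Lemma is_derive_dominator_primitive y : 0 < y ->
  is_derive y 1 dominator_primitive (dominator y).
Proof.
move=> y0; have ? := is_derive1_powR (1 - a) y0.
rewrite (_ : dominator y = - (1 - a)^-1 * (expR (- y `^ (1 - a)) *
    - ((1 - a) * y `^ (1 - a - 1)))); last first.
  rewrite /dominator addrAC subrr sub0r; field.
  by rewrite gt_eqF.
exact: is_derive_fctZ.
Qed.

Lemma dominator_primitive_cvg0 :
  dominator_primitive y @[y --> 0^'+] --> - (1 - a)^-1.
Proof.
rewrite (_ : - (1 - a)^-1 = - (1 - a)^-1 * expR (- 0)); last first.
  by rewrite oppr0 expR0 mulr1.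
apply: cvgMl_tmp; apply: continuous_cvg; first exact: continuous_expR.
by apply: cvgN; exact: powR_cvg0.
Qed.

Lemma dominator_primitive_cvgy : dominator_primitive y @[y --> +oo] --> 0.
Proof.
rewrite -[X in _ --> X](mulr0 (- (1 - a)^-1)); apply: cvgMl_tmp.
apply: (@cvg_comp _ _ _ (fun y => y `^ (1 - a)) (fun y => expR (- y)) _ +oo);
  last exact: cvgr_expR.
apply/cvgryPge => A; near=> y.
have y1 : 1 <= y by near: y; apply: nbhs_pinfty_ge; exact: num_real.
(* The threshold is max(A, 1)^(1/(1 - a)); the maximum with 1 keeps the argument of the logarithm
   positive. *)
have yA : expR (ln (Num.max A 1) / (1 - a)) <= y.
  by near: y; apply: nbhs_pinfty_ge; exact: num_real.
rewrite (@le_trans _ _ (Num.max A 1)) ?le_max ?lexx//.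
rewrite -[leLHS]lnK ?posrE ?lt_max ?ltr01 ?orbT//.
rewrite -[X in expR X](divfK (lt0r_neq0 onema_gt0)) expRM.
by apply: ge0_ler_powR; rewrite ?nnegrE ?expR_ge0 ?ltW// (lt_le_trans ltr01 y1).
Unshelve. all: end_near. Qed.

Lemma integral_dominator :
  (\int[mu]_(y in `]0%R, +oo[) (dominator y)%:E)%E = ((1 - a)^-1)%:E.
Proof.
rewrite -[X in _ = X%:E]opprK -[X in _ = X%:E]sub0r.
apply: (ge0_FTC_oy (f := dominator) (F := dominator_primitive)).
- by move=> y _; exact: dominator_ge0.
- by move=> y; exact: continuous_dominator.
- exact: is_derive_dominator_primitive.
- exact: dominator_primitive_cvg0.
- exact: dominator_primitive_cvgy.
Qed.

Lemma integrable_dominator : mu.-integrable `]0, +oo[ (EFin \o dominator).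
Proof.
apply/integrableP; split.
  by apply/measurable_EFinP; apply: measurable_fun_continuous_oy; exact: continuous_dominator.
under eq_integral do rewrite /= ger0_norm ?dominator_ge0//.
by rewrite integral_dominator ltry.
Qed.

Lemma integrable_moment_kernel k x : mu.-integrable `]0, +oo[ (EFin \o w k x).
Proof.
set K := expR ((k%:R + `|x| + 1) ^+ 2 / 2 + 1).
have intK : mu.-integrable `]0, +oo[ (fun y => K%:E * (dominator y)%:E)%E.
  by apply: integrableZl => //; exact: integrable_dominator.
apply: le_integrable intK => //.
- by apply/measurable_EFinP; apply: measurable_fun_continuous_oy; exact: continuous_moment_kernel.
- move=> y /=; rewrite in_itv/= andbT => y0.
  rewrite lee_fin !ger0_norm ?moment_kernel_le ?(ltW (moment_kernel_gt0 _ _ y0))//.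
  by rewrite mulr_ge0 ?expR_ge0 ?dominator_ge0.
Qed.

Lemma moment_gt0 k x : 0 < m k x.
Proof.
apply: Rintegral_gt0 => //.
- by rewrite [ltRHS](lebesgue_measure_itv `]0%R, +oo[)/= ltry addye ?ltry.
- exact: integrable_moment_kernel.
- by move=> y /=; rewrite in_itv/= andbT; exact: moment_kernel_gt0.
Qed.

Lemma is_derive_moment_kernel k x y : is_derive x 1 (w k ^~ y) (w k.+1 x y).
Proof.
have -> : w k.+1 x y = y `^ (- a) * (y ^+ k * (expR (x * y - y ^+ 2 / 2) * (1 * y + x * 0 - 0))).
  by rewrite /moment_kernel exprS; ring.
do 2!apply: is_derive_fctZ; apply: is_derive_fct_expR; apply: is_derive_fctB.
exact: is_derive_fctM.
Qed.

Lemma is_derive_moment k x : is_derive x 1 (m k) (m k.+1 x).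
Proof.
have xI : `](x - 1), (x + 1)[%classic x.
  by rewrite /= in_itv/= ltrBlDr ltrDl ltr01.
have intw u : `](x - 1), (x + 1)[%classic u ->
    mu.-integrable `]0%R, +oo[ (EFin \o w k u).
  by move=> _; exact: integrable_moment_kernel.
have dw u y : `](x - 1), (x + 1)[%classic u -> `]0, +oo[%classic y ->
    derivable (w k ^~ y) u 1.
  by move=> _ _; have [] := is_derive_moment_kernel k u y.
(* On the interval of radius 1 around [x] one has |u| <= |x| + 1; the index is [k.+1] because the
   differentiated kernel is the one to dominate. *)
pose K := expR ((k.+1%:R + (`|x| + 1) + 1) ^+ 2 / 2 + 1).
pose G := K \*o dominator.
have G0 y : 0 <= G y by rewrite mulr_ge0 ?expR_ge0 ?dominator_ge0.
have intG : mu.-integrable `]0, +oo[ (EFin \o G).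
  have intK : mu.-integrable `]0, +oo[ (fun y => K%:E * (dominator y)%:E)%E.
    by apply: integrableZl => //; exact: integrable_dominator.
  exact: intK.
have p1E u y : partial1of2 (w k) u y = w k.+1 u y.
  by rewrite partial1of2E; have [] := is_derive_moment_kernel k u y.
have ubG u y : `](x - 1), (x + 1)[%classic u -> `]0, +oo[%classic y ->
    `|partial1of2 (w k) u y| <= G y.
  rewrite /= !in_itv/= andbT p1E => /andP[ux xu] y0.
  rewrite ger0_norm ?(ltW (moment_kernel_gt0 _ _ y0))//.
  apply: moment_kernel_le => //.
  have : `|u| <= `|x| + `|u - x| by rewrite -{1}(subrK x u) addrC ler_normD.
  move/le_trans; apply; rewrite lerD2l ler_norml; apply/andP; split; lra.
apply: DeriveDef.
  exact: (derivable_under_integral _ xI intw dw G0 intG ubG).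
rewrite -derive1E (differentiation_under_integral _ xI intw dw G0 intG ubG)//.
by apply: eq_Rintegral => y _; rewrite p1E.
Qed.

(* The right-hand side minus the left-hand side is the integral of the
   derivative of [y `^ (1 - a) * expR (x * y - y ^+ 2 / 2)], which vanishes at both
   ends; adding a multiple of [dominator] makes the integrand nonnegative. *)
Lemma moment_rec x : m 2 x = x * m 1 x + (1 - a) * m 0 x.
Proof.
pose F y := y `^ (1 - a) * expR (x * y - y ^+ 2 / 2).
pose f y := (1 - a) * w 0 x y + x * w 1 x y - w 2 x y.
pose K k := expR ((k%:R + `|x| + 1) ^+ 2 / 2 + 1).
(* [C * dominator] outweighs the negative terms of [f]; its known integral is subtracted at the
   end. *)
pose C := K 0 + `|x| * K 1 + K 2.
have Kd k y : 0 < y -> 0 <= w k x y <= K k * dominator y.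
  by move=> y0; rewrite moment_kernel_le// ltW ?moment_kernel_gt0.
have fC y : 0 < y -> 0 <= f y + C * dominator y.
  move=> y0; rewrite /f /C.
  have /andP[w0 _] := Kd 0 y y0; have /andP[w1 w1K] := Kd 1 y y0.
  have /andP[_ w2K] := Kd 2 y y0.
  have b0 : 0 <= (1 - a) * w 0 x y by rewrite mulr_ge0// ltW.
  have : - (x * w 1 x y) <= `|x| * (K 1 * dominator y).
    rewrite -mulNr (@le_trans _ _ (`|x| * w 1 x y)) ?ler_wpM2l//.
    by rewrite ler_wpM2r// -normrN ler_norm.
  have : 0 <= K 0 * dominator y by rewrite mulr_ge0 ?expR_ge0 ?dominator_ge0.
  lra.
have dF y : 0 < y -> is_derive y 1 F (f y).
  move=> y0; have ? := is_derive1_powR (1 - a) y0.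
  rewrite (_ : f y = (1 - a) * y `^ (1 - a - 1) * expR (x * y - y ^+ 2 / 2) +
      y `^ (1 - a) * (expR (x * y - y ^+ 2 / 2) * (x * 1 - y))).
    apply: is_derive_fctM; apply: is_derive_fct_expR.
    by apply: is_derive_fctB; exact: is_derive_half_sqr.
  rewrite (_ : y `^ (1 - a) = y * y `^ (- a)); last first.
    by rewrite powRD ?gt_eqF ?implybT// powRr1 ?ltW.
  rewrite (_ : 1 - a - 1 = - a) /f /moment_kernel; last by ring.
  by rewrite expr0 expr1; ring.
have cf y : 0 < y -> {for y, continuous f}.
  move=> y0; have cw k := @continuous_moment_kernel k x y y0.
  apply: cvgB; last exact: cw.
  by apply: cvgD; apply: cvgMl_tmp; exact: cw.
have intw k := integrable_moment_kernel k x.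
have intwZ c k : mu.-integrable `]0, +oo[ (EFin \o (fun y => c * w k x y)).
  have h : mu.-integrable `]0, +oo[ (fun y => c%:E * (w k x y)%:E)%E.
    by apply: integrableZl => //; exact: intw.
  exact: h.
have intwD : mu.-integrable `]0, +oo[
    (EFin \o (fun y => (1 - a) * w 0 x y + x * w 1 x y)).
  have h : mu.-integrable `]0, +oo[
      (fun y => ((1 - a) * w 0 x y)%:E + (x * w 1 x y)%:E)%E.
    by apply: integrableD => //; exact: intwZ.
  exact: h.
have intf : mu.-integrable `]0, +oo[ (EFin \o f).
  have h : mu.-integrable `]0, +oo[
      (fun y => ((1 - a) * w 0 x y + x * w 1 x y)%:E - (w 2 x y)%:E)%E.
    by apply: integrableB => //; exact: intw.
  exact: h.
have intK : mu.-integrable `]0, +oo[ (fun y => C%:E * (dominator y)%:E)%E.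
  by apply: integrableZl => //; exact: integrable_dominator.
have fE : \int[mu]_(y in `]0, +oo[) f y = (1 - a) * m 0 x + x * m 1 x - m 2 x.
  rewrite /f RintegralB// RintegralD// !RintegralZl//; exact: intw.
suff : \int[mu]_(y in `]0, +oo[) f y = 0 by rewrite fE; lra.
(* The right-hand side is the limit of the primitive at infinity minus its limit at 0, unsimplified
   to match the limits proved below. It equals C / (1 - a), which is exactly the integral of
   [C * dominator]. *)
have : (\int[mu]_(y in `]0%R, +oo[) (f y + C * dominator y)%:E)%E =
    (0 + C * 0 - (0 * expR (x * 0 - 0 ^+ 2 / 2) + C * - (1 - a)^-1))%:E.
  apply: (ge0_FTC_oy (F := fun y => F y + C * dominator_primitive y)) => //.
  - move=> y y0; apply: cvgD; first exact: cf.
    by apply: cvgMl_tmp; exact: continuous_dominator.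
  - move=> y y0; apply: is_derive_fctD; first exact: dF.
    by apply: is_derive_fctZ; exact: is_derive_dominator_primitive.
  - apply: cvgD; last by apply: cvgMl_tmp; exact: dominator_primitive_cvg0.
    apply: cvgM; first exact: powR_cvg0.
    apply: cvg_at_right_filter.
    suff /is_derive_continuous : is_derive (0 : R) 1
        (fun y => expR (x * y - y ^+ 2 / 2))
        (expR (x * 0 - 0 ^+ 2 / 2) * (x * 1 - 0)) by [].
    apply: is_derive_fct_expR.
    by apply: is_derive_fctB; exact: is_derive_half_sqr.
  - apply: cvgD; last by apply: cvgMl_tmp; exact: dominator_primitive_cvgy.
    (* From y^(1 - a) <= e^y, the exponent is at most (x + 1) y - y^2/2 <= (x + 2)^2/2 - y, by
       completing the square. *)
    pose c := expR ((x + 2) ^+ 2 / 2).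
    apply: (@squeeze_cvgr _ _ _ _ (cst 0) (fun y => c * expR (- y))).
    + near=> y.
      have y0 : 0 < y by near: y; apply: nbhs_pinfty_gt; exact: num_real.
      rewrite mulr_ge0 ?powR_ge0 ?expR_ge0//= /c -expRD.
      rewrite (@le_trans _ _ (expR y * expR (x * y - y ^+ 2 / 2)))//.
        by rewrite ler_wpM2r ?expR_ge0// (le_trans (powR_le1D y0)) ?expR_ge1Dx.
      rewrite -expRD ler_expR; have := sqr_ge0 (x + 2 - y); nra.
    + exact: cvg_cst.
    + rewrite -[X in _ --> X](mulr0 c); apply: cvgMl_tmp; exact: cvgr_expR.
under eq_integral do rewrite EFinD EFinM.
rewrite integralD//= integralZl// ?integral_dominator; last exact: integrable_dominator.
rewrite -[X in (X + _)%E]fineK; last exact: integrable_fin_num.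
by rewrite -EFinM -EFinD => -[]; rewrite /Rintegral; lra.
Unshelve. all: end_near. Qed.

End kernel.

(** * The equation p'' + x p' + a p = 0 *)

(** Mean value theorem. Positivity is asked only inside the interval, since some derivatives below
    vanish at its left end. *)
Lemma ltr_is_derive (R : realType) (f df : R -> R) (c d : R) : c < d ->
  (forall x, c <= x <= d -> is_derive x 1 f (df x)) ->
  (forall x, c < x < d -> 0 < df x) -> f c < f d.
Proof.
move=> cd dfE df0.
have dfo x : x \in `]c, d[ -> is_derive x 1 f (df x).
  by rewrite in_itv/= => /andP[cx xd]; apply: dfE; rewrite !ltW.
have cf : {within `[c, d], continuous f}.
  by apply: derivable_within_continuous => x; rewrite in_itv/= => /dfE[].
have [e] := MVT cd dfo cf; rewrite in_itv/= => /df0 de0 fE.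
by rewrite -subr_gt0 fE mulr_gt0// subr_gt0.
Qed.

(* The second derivative of a solution [p] of [p'' + x p' + a p = 0], where [q = p']. *)
Definition hermite2 (R : realType) (a : R) (p q : R -> R) (x : R) : R :=
  - x * q x - a * p x.

Section hermite_equation.
Context {R : realType} (a : R) (p q : R -> R).
Local Notation u := (hermite2 a p q).
Hypotheses (a_gt0 : 0 < a) (p_gt0 : forall x, 0 < p x).
Hypotheses (dp : forall x : R, is_derive x 1 p (q x))
  (dq : forall x : R, is_derive x 1 q (u x)).
Hypotheses (q_gt0 : forall x, x <= 0 -> 0 < q x) (u_gt0 : 0 < u (- 1)).

Local Notation E x := (expR (x ^+ 2 / 2)).

Let E_gt0 (x : R) : 0 < E x. Proof. exact: expR_gt0. Qed.

Let dE (x : R) : is_derive x 1 (fun t => E t) (E x * x).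
Proof. exact: is_derive_fct_expR (is_derive_half_sqr x). Qed.

Lemma is_derive_hermite2 (x : R) : is_derive x 1 u (- x * u x - (1 + a) * q x).
Proof.
have := is_derive_fctB (is_derive_fctM (is_derive_fctN (is_derive_id x (1 : R))) (dq x))
  (is_derive_fctZ a (dp x)).
by move/is_derive_eq; apply; ring.
Qed.
Local Notation du := is_derive_hermite2.

Let u0 : u 0 < 0. Proof. by rewrite /hermite2 oppr0 mul0r sub0r oppr_lt0 mulr_gt0. Qed.

Lemma hermite2_decr x y : x < y -> y <= 0 -> E y * u y < E x * u x.
Proof.
move=> xy y0; rewrite -ltrN2.
apply: (ltr_is_derive (f := fun t => - (E t * u t))
  (df := fun t => (1 + a) * (E t * q t)) xy) => t.
  move=> _; have := is_derive_fctN (is_derive_fctM (dE t) (du t)).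
  by move/is_derive_eq; apply; ring.
move=> /andP[_ ty]; rewrite !mulr_gt0 ?addr_gt0// q_gt0//.
by rewrite ltW// (lt_le_trans ty).
Qed.

(** Applied with [y] the zero [x1], this turns sigma >= [sigma_low], that is - sigma z <= x1, into
    u(- sigma z) >= 0. *)
Lemma hermite2_ge0 x y : x <= y -> y <= 0 -> u y = 0 -> 0 <= u x.
Proof.
rewrite le_eqVlt => /predU1P[->|xy] y0 uy; first by rewrite uy.
have := hermite2_decr xy y0.
by rewrite uy mulr0 pmulr_rgt0 // => /ltW.
Qed.

(** Intermediate values on [-1, 0]: u(-1) > 0 by hypothesis and u(0) = - a p(0) < 0. *)
Lemma hermite2_zero : exists x, x < 0 /\ u x = 0.
Proof.
have cu : {within `[-1, 0], continuous u}.
  by apply: derivable_within_continuous => x _; have [] := du x.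
have [|c + uc] := IVT (lerN10 R) cu (v := 0).
  by rewrite ge_min le_max !(ltW u0) (ltW u_gt0) orbT.
rewrite in_itv/= => /andP[_ c0]; exists c; split=> //.
rewrite lt_neqAle c0 andbT; apply/eqP => c0'.
by move: u0; rewrite -[X in u X]c0' uc ltxx.
Qed.

(** First and second derivatives of the even solution h(x) = p(x) + p(-x). *)
Local Notation h' x := (q x - q (- x)).
Local Notation h'' x := (u x + u (- x)).

Let dh' (x : R) : is_derive x 1 (fun t => h' t) (h'' x).
Proof.
have := is_derive_fctB (dq x) (is_derive_fct_opp (dq (- x))).
by move/is_derive_eq; apply; rewrite opprK.
Qed.

Let dh'' (x : R) : is_derive x 1 (fun t => h'' t) (- x * h'' x - (1 + a) * h' x).
Proof.
have := is_derive_fctD (du x) (is_derive_fct_opp (du (- x))).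
by move/is_derive_eq; apply; ring.
Qed.

Lemma even_hermite1_decr x y : x < y -> E y * h' y < E x * h' x.
Proof.
move=> xy; rewrite -ltrN2.
apply: (ltr_is_derive (f := fun t => - (E t * h' t))
  (df := fun t => a * (E t * (p t + p (- t)))) xy) => t.
  move=> _; have := is_derive_fctN (is_derive_fctM (dE t) (dh' t)).
  by move/is_derive_eq; apply; rewrite /hermite2; ring.
by move=> _; rewrite !mulr_gt0 ?addr_gt0.
Qed.

Let h'0 x : 0 < x -> E x * h' x < 0.
Proof. by move/even_hermite1_decr; rewrite oppr0 subrr mulr0. Qed.

Let dEh'' (x : R) : is_derive x 1 (fun t => E t * h'' t) (- ((1 + a) * (E x * h' x))).
Proof.
have := is_derive_fctM (dE x) (dh'' x).
by move/is_derive_eq; apply; ring.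
Qed.

Lemma even_hermite2_incr x y : 0 <= x -> x < y -> E x * h'' x < E y * h'' y.
Proof.
move=> x0 xy; apply: (ltr_is_derive xy (fun t _ => dEh'' t)) => t /andP[xt _].
by rewrite oppr_gt0 pmulr_rlt0 ?addr_gt0// h'0// (le_lt_trans x0).
Qed.

Lemma even_hermite2_lt0 x y : 0 <= x -> x < y -> h'' y = 0 -> h'' x < 0.
Proof.
by move=> x0 /(even_hermite2_incr x0) + uy; rewrite uy mulr0 pmulr_rlt0.
Qed.

(** E h'' is negative at 0, and its derivative is a positive multiple of - E h', which increases.
    Beyond 1 the growth is thus at least linear, with slope [c] > 0, and the sign changes. *)
Lemma even_hermite2_zero : exists x, 0 < x /\ h'' x = 0.
Proof.
pose G t := E t * h'' t.
pose c := - ((1 + a) * (E 1 * h' 1)).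
have c0 : 0 < c by rewrite oppr_gt0 pmulr_rlt0 ?addr_gt0// h'0.
(* Chosen so that c (X - 1) = c + |G 1|, which exceeds - G 1. *)
pose X := 2 + `|G 1| / c.
have X1 : 1 < X.
  by rewrite (@lt_le_trans _ _ 2) ?ltrDl// lerDl divr_ge0// ltW.
have GX : 0 < G X.
  have : G 1 - c * 1 < G X - c * X.
    apply: (ltr_is_derive (f := fun t => G t - c * t)
      (df := fun t => - ((1 + a) * (E t * h' t)) - c * 1) X1) => [t _|t /andP[t1 _]].
      exact: is_derive_fctB (dEh'' t) (is_derive_fctZ c (is_derive_id t (1 : R))).
    by rewrite /c mulr1 opprK addrC subr_gt0 ltr_pM2l ?addr_gt0// even_hermite1_decr.
  have -> : c * X = c * 2 + `|G 1| by rewrite /X; field; rewrite gt_eqF.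
  have := ler_norm (- G 1); rewrite normrN; lra.
have cG : {within `[0, X], continuous G}.
  by apply: derivable_within_continuous => x _; have [] := dEh'' x.
have G0 : G 0 < 0.
  by rewrite /G pmulr_rlt0// oppr0 -mulr2n pmulrn_llt0.
have X0 : 0 <= X by rewrite ltW// (lt_trans _ X1).
have [|z + Gz] := IVT X0 cG (v := 0).
  by rewrite ge_min le_max (ltW G0) (ltW GX) orbT.
rewrite in_itv/= => /andP[z0 _]; exists z; split.
  rewrite lt_neqAle z0 andbT; apply/eqP => z0'.
  by move: G0; rewrite [X in G X]z0' Gz ltxx.
by move/eqP: Gz; rewrite mulf_eq0 gt_eqF//= => /eqP.
Qed.

(** The Wronskian of p(-x) and p(x); the plus sign comes from differentiating p(-x). *)
Definition wronskian x := q x * p (- x) + p x * q (- x).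

(** Abel's identity: p(-x) solves the same equation as p(x), so E times the Wronskian is constant,
    with value 2 p(0) q(0) > 0. *)
Lemma wronskian_gt0 x : 0 < wronskian x.
Proof.
have dEw (t : R) : is_derive t 1 (fun t => E t * wronskian t) 0.
  have := is_derive_fctM (dE t) (is_derive_fctD
    (is_derive_fctM (dq t) (is_derive_fct_opp (dp (- t))))
    (is_derive_fctM (dp t) (is_derive_fct_opp (dq (- t))))).
  by move/is_derive_eq; apply; rewrite /wronskian /hermite2; ring.
rewrite -(pmulr_rgt0 _ (E_gt0 x)) (is_derive_0_is_cst x 0 dEw).
by rewrite /wronskian oppr0 !(mulr_gt0, addr_gt0)// q_gt0.
Qed.

(* The Wronskian of [u] and [t |-> u (- t)] is a positive multiple of
   [wronskian], so [u t / u (- t)] increases where the denominator is positive. *)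
Lemma hermite2_cross s x : 0 <= s <= x -> 0 <= u (- s) -> u s < 0 ->
  u s * u (- x) <= u (- s) * u x.
Proof.
move=> /andP[s0]; rewrite le_eqVlt => /predU1P[<-|sx]; first by rewrite mulrC.
move=> ums us0.
have v_gt0 t : s < t -> 0 < u (- t).
  move=> st; have : E (- s) * u (- s) < E (- t) * u (- t).
    by apply: hermite2_decr; rewrite ?ltrN2// oppr_le0.
  move/(le_lt_trans (mulr_ge0 (ltW (E_gt0 _)) ums)).
  by rewrite pmulr_rgt0.
(* At sigma = [sigma_low] the quotient has a zero denominator at [s]; there the right-hand side is 0
   and signs conclude. *)
have [ums0|ums0] := eqVneq (u (- s)) 0.
  by rewrite ums0 mul0r nmulr_rle0// ltW// v_gt0.
have {ums0}ums0 : 0 < u (- s) by rewrite lt_neqAle eq_sym ums0.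
have v0 t : s <= t -> 0 < u (- t).
  by rewrite le_eqVlt => /predU1P[<-//|]; exact: v_gt0.
(* In the numerator u'(t) u(-t) + u(t) u'(-t) the terms in t u(t) u(-t) cancel, then those in q(t)
   q(-t), leaving a (1 + a) times the Wronskian. *)
pose df t := a * (1 + a) * wronskian t / u (- t) ^+ 2.
have : u s * (u (- s))^-1 < u x * (u (- x))^-1.
  apply: (ltr_is_derive (f := fun t => u t * (u (- t))^-1) (df := df) sx) => t.
    move=> /andP[/v0/lt0r_neq0 vt _].
    have := is_derive_fctM (du t) (is_deriveV (f := fun t => u (- t)) vt (is_derive_fct_opp (du (- t)))).
    move/is_derive_eq; apply; rewrite /df /wronskian /GRing.scale/=.
    have := vt; rewrite /hermite2 opprK; move: (q t) (p t) (q (- t)) (p (- t)) => qt pt qmt pmt vt'.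
    by field.
  move=> /andP[/v_gt0 vt _];
    rewrite /df divr_gt0 ?exprn_gt0// mulr_gt0 ?wronskian_gt0// mulr_gt0//.
    by rewrite addr_gt0.
rewrite ltr_pdivrMr// mulrAC ltr_pdivlMr ?v_gt0//.
by move/ltW; rewrite [u x * _]mulrC.
Qed.

End hermite_equation.

(** * Gluing two functions at a point *)

Section piecewise.
Context {R : realType}.
Implicit Types (f g : R -> R) (P : pred R).

Lemma cvg_if (T : Type) (F : set_system T) (FF : Filter F) (P : pred T)
    (f g : T -> R) (l : R) :
  f @ F --> l -> g @ F --> l -> (fun x => if P x then f x else g x) @ F --> l.
Proof.
move=> /cvgrPdist_lt fl /cvgrPdist_lt gl; apply/cvgrPdist_lt => e e0.
near=> x; case: (P x); near: x; [exact: fl|exact: gl].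
Unshelve. all: end_near. Qed.

(** As f x = g x, each difference quotient of the glued function is one of [f] or of [g], and both
    tend to [d], whatever [P] is. *)
Lemma is_derive_if_eq P f g x d : f x = g x ->
  is_derive x 1 f d -> is_derive x 1 g d ->
  is_derive x 1 (fun t => if P t then f t else g t) d.
Proof.
move=> fgx [df <-] [dg dgE]; set k := fun t => _.
have kx : k x = f x by rewrite /k -fgx if_same.
have cvgk : h^-1 *: ((k \o shift x) (h *: 1) - k x) @[h --> 0^'] --> 'D_1 f x.
  have -> : (fun h => h^-1 *: ((k \o shift x) (h *: 1) - k x)) =
      (fun h => if P (h *: 1 + x) then h^-1 *: ((f \o shift x) (h *: 1) - f x)
                else h^-1 *: ((g \o shift x) (h *: 1) - g x)).
    by apply/funext => h; rewrite kx /= /k; case: ifP => // _; rewrite fgx.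
  by apply: cvg_if; [exact: df|rewrite -dgE; exact: dg].
by apply: DeriveDef; [apply/cvg_ex; exists ('D_1 f x)|exact/cvg_lim].
Qed.

Lemma near_if (T : Type) P (f g : R -> T) x : (\forall t \near x, P t = P x) ->
  \forall t \near x, (if P t then f t else g t) = (if P x then f t else g t).
Proof. by apply: filterS => t ->. Qed.

(** Away from [c] the test [P] is locally constant, so one branch is differentiated. This form
    serves both tests, [x <= c] and [x < c]. *)
Lemma is_derive_if P f g (f' g' : R -> R) c :
  (forall x, x != c -> \forall t \near x, P t = P x) ->
  (forall x : R, is_derive x 1 f (f' x)) -> (forall x : R, is_derive x 1 g (g' x)) ->
  f c = g c -> f' c = g' c -> forall x : R,
  is_derive x 1 (fun t => if P t then f t else g t) (if P x then f' x else g' x).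
Proof.
move=> Pc df dg fgc fgc' x; have [->|xc] := eqVneq x c.
  by apply: is_derive_if_eq; rewrite -?fgc' ?if_same// fgc'.
apply: near_eq_is_derive (_ : is_derive x 1 (if P x then f else g) _).
  have := near_if f g (Pc x xc); apply: filterS => t ->; by case: (P x).
by case: (P x).
Qed.

Lemma continuous_if P f g c :
  (forall x, x != c -> \forall t \near x, P t = P x) ->
  continuous f -> continuous g -> f c = g c ->
  continuous (fun t => if P t then f t else g t).
Proof.
move=> Pc cf cg fgc x; have [->|xc] := eqVneq x c.
  rewrite /continuous_at -fgc if_same; apply: cvg_if; first exact: cf.
  by rewrite fgc; exact: cg.
have cfg : {for x, continuous (if P x then f else g)}.
  by case: (P x); [exact: cf|exact: cg].
have E := near_if f g (Pc x xc); rewrite /continuous_at.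
rewrite (_ : (if P x then f x else g x) = (if P x then f else g) x); last by case: (P x).
apply: cvg_trans cfg; apply: near_eq_cvg; apply: filterS E => t ->. by case: (P x).
Qed.

Lemma near_le_cst (c x : R) : x != c -> \forall t \near x, (t <= c) = (x <= c).
Proof.
rewrite neq_lt => /orP[xc|cx].
  by near=> t; rewrite (ltW xc) ltW//; near: t; exact: lt_nbhsl.
by near=> t; rewrite !leNgt cx; congr (~~ _); near: t; exact: lt_nbhsr.
Unshelve. all: end_near. Qed.

Lemma near_lt_cst (c x : R) : x != c -> \forall t \near x, (t < c) = (x < c).
Proof.
rewrite neq_lt => /orP[xc|cx].
  by near=> t; rewrite xc; near: t; exact: lt_nbhsl.
by near=> t; rewrite !ltNge (ltW cx) ltW//; near: t; exact: lt_nbhsr.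
Unshelve. all: end_near. Qed.

End piecewise.

(** * The function phi and the glued solution *)

Section phi.
Context {R : realType} (lambda : R).
Hypotheses (lambda_gt0 : 0 < lambda) (lambda_lt : lambda < 1 / 2).
Local Notation a := (2 * lambda).
Let a_gt0 : 0 < a. Proof. by rewrite mulr_gt0. Qed.
Let a_lt1 : a < 1. Proof. by rewrite mulrC -ltr_pdivlMr. Qed.

Local Notation p := (phi lambda).
Local Notation m := (moment a).

Lemma phiE x : p x = expR (- (x ^+ 2 / 2)) * m 0 x.
Proof.
rewrite /phi /moment -RintegralZl//; last exact: integrable_moment_kernel.
apply: eq_Rintegral => y _; rewrite /moment_kernel expr0 mul1r mulrCA -expRD.
by congr (_ * expR _); field.
Qed.

Lemma phi_gt0 x : 0 < p x.
Proof. by rewrite phiE mulr_gt0 ?expR_gt0 ?moment_gt0. Qed.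

Let phi' (x : R) := expR (- (x ^+ 2 / 2)) * (m 1 x - x * m 0 x).

Let dexp (x : R) : is_derive x 1 (fun t => expR (- (t ^+ 2 / 2)))
  (expR (- (x ^+ 2 / 2)) * - x).
Proof. exact: is_derive_fct_expR (is_derive_fctN (is_derive_half_sqr x)). Qed.

Let dphi (x : R) : is_derive x 1 p (phi' x).
Proof.
rewrite (funext phiE).
have := is_derive_fctM (dexp x) (is_derive_moment a_gt0 a_lt1 0 x).
by move/is_derive_eq; apply; rewrite /phi'; ring.
Qed.

Lemma phi_derive1E x : p^`() x = expR (- (x ^+ 2 / 2)) * (m 1 x - x * m 0 x).
Proof. by rewrite derive1E; have [_ ->] := dphi x. Qed.

Lemma is_derive_phi (x : R) : is_derive x 1 p (p^`() x).
Proof. by rewrite phi_derive1E; exact: dphi. Qed.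

(** Differentiating e^(-x^2/2) (m_1 - x m_0) produces m_2, which [moment_rec] eliminates. *)
Lemma is_derive_phi1 (x : R) : is_derive x 1 p^`() (hermite2 a p p^`() x).
Proof.
have dm k := is_derive_moment a_gt0 a_lt1 k x.
rewrite /hermite2 phi_derive1E (funext phi_derive1E) phiE.
have := is_derive_fctM (dexp x)
  (is_derive_fctB (dm 1) (is_derive_fctM (is_derive_id x (1 : R)) (dm 0))).
by move/is_derive_eq; apply; rewrite (moment_rec a_gt0 a_lt1); ring.
Qed.

Lemma phi_derive2E x : p^`(2) x = hermite2 a p p^`() x.
Proof. by rewrite [LHS]derive1E; have [_ ->] := is_derive_phi1 x. Qed.

Lemma phi_derive1_gt0 x : x <= 0 -> 0 < p^`() x.
Proof.
move=> x0; rewrite phi_derive1E mulr_gt0 ?expR_gt0// ltr_wpDr ?moment_gt0//.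
by rewrite -mulNr mulr_ge0 ?oppr_ge0// ltW ?moment_gt0.
Qed.

(** At -1 the second derivative is e^(-1/2) (m_1 + (1 - a) m_0), and a < 1. *)
Lemma phi_derive2N1_gt0 : 0 < hermite2 a p p^`() (- 1).
Proof.
rewrite /hermite2 phi_derive1E phiE opprK mul1r mulrCA -mulrBr mulr_gt0 ?expR_gt0//.
have := moment_gt0 a_gt0 a_lt1 1 (-1); have := moment_gt0 a_gt0 a_lt1 0 (-1).
move: (m 0 _) (m 1 _) => m0 m1 m0_gt0 m1_gt0.
have : a * m0 < m0 by rewrite gtr_pMl.
lra.
Qed.

End phi.

(** * Gluing the outer combinations to the rescaled even solution *)

Section piecewise_solution.
Context {R : realType} (a sigma z : R) (p q : R -> R).
Local Notation u := (hermite2 a p q).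
Local Notation s := (sigma * z).
Hypotheses (a_gt0 : 0 < a) (p_gt0 : forall x, 0 < p x).
Hypotheses (dp : forall x : R, is_derive x 1 p (q x))
  (dq : forall x : R, is_derive x 1 q (u x)).
Hypothesis q_gt0 : forall x, x <= 0 -> 0 < q x.
Hypotheses (z_gt0 : 0 < z) (uz : u z + u (- z) = 0).
Hypotheses (sigma_gt0 : 0 < sigma) (sigma_lt1 : sigma < 1).
Hypothesis us_ge0 : 0 <= u (- s).

Definition comb (c1 c2 : R) (f : R -> R) x := c1 * f x + c2 * f (- x).

(** Determinant of the linear system m2 p(s) + m1 p(-s) = p(z) + p(-z), m2 u(s) + m1 u(-s) = 0,
    which Cramer's rule solves by [coef1] and [coef2]. *)
Definition cross := p s * u (- s) - p (- s) * u s.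
Definition coef1 := - u s * (p (- z) + p z) / cross.
Definition coef2 := u (- s) * (p (- z) + p z) / cross.
Local Notation N := cross.
Local Notation m1 := coef1.
Local Notation m2 := coef2.

Definition glued x := if x <= - s then comb m1 m2 p x
  else if x < s then comb 1 1 p (x / sigma) else comb m2 m1 p x.

Definition glued1 x := if x <= - s then comb m1 (- m2) q x
  else if x < s then sigma^-1 * comb 1 (- 1) q (x / sigma) else comb m2 (- m1) q x.

Definition glued2 x := if x <= - s then comb m1 m2 u x
  else if x < s then sigma^-1 ^+ 2 * comb 1 1 u (x / sigma) else comb m2 m1 u x.

Let s_gt0 : 0 < s. Proof. exact: mulr_gt0. Qed.

Let du (x : R) := is_derive_hermite2 dp dq x.

Let even_le0 x : 0 <= x <= z -> u x + u (- x) <= 0.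
Proof.
move=> /andP[x0]; rewrite le_eqVlt => /predU1P[->|xz]; first by rewrite uz.
exact: ltW (even_hermite2_lt0 a_gt0 p_gt0 dp dq x0 xz uz).
Qed.

(** Since 0 < s < z, the sum u(s) + u(-s) is negative, while u(-s) >= 0. *)
Let us_lt0 : u s < 0.
Proof.
have sz : s < z by rewrite gtr_pMl.
have := even_hermite2_lt0 a_gt0 p_gt0 dp dq (ltW s_gt0) sz uz.
by apply: le_lt_trans; rewrite lerDl.
Qed.

Let N_gt0 : 0 < N.
Proof. by rewrite ltr_wpDl ?mulr_ge0 ?(ltW (p_gt0 _))// -mulrN mulr_gt0// oppr_gt0. Qed.

Lemma coef1_gt0 : 0 < m1.
Proof. by rewrite divr_gt0// mulr_gt0 ?oppr_gt0// addr_gt0. Qed.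

Lemma coef2_ge0 : 0 <= m2.
Proof. by rewrite divr_ge0 ?mulr_ge0// ltW// addr_gt0. Qed.

Lemma glued_gt0 x : 0 < glued x.
Proof.
have h1 y : 0 < m1 * p y by exact: mulr_gt0 coef1_gt0 (p_gt0 y).
have h2 y : 0 <= m2 * p y by exact: mulr_ge0 coef2_ge0 (ltW (p_gt0 y)).
rewrite /glued; case: ifP => _; [exact: ltr_pwDl|case: ifP => _].
  by rewrite /comb !mul1r; exact: addr_gt0.
exact: ltr_wpDl.
Qed.

Let dcomb c1 c2 (f f' : R -> R) : (forall x : R, is_derive x 1 f (f' x)) ->
  forall x : R, is_derive x 1 (comb c1 c2 f) (comb c1 (- c2) f' x).
Proof.
move=> df x.
have := is_derive_fctD (is_derive_fctZ c1 (df x))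
  (is_derive_fctZ c2 (is_derive_fct_opp (df (- x)))).
by move/is_derive_eq; apply; rewrite /comb mulrN mulNr.
Qed.

Let dscale (f f' : R -> R) : (forall x : R, is_derive x 1 f (f' x)) ->
  forall x : R, is_derive x 1 (fun t => f (t / sigma)) (sigma^-1 * f' (x / sigma)).
Proof.
move=> df x; have dx : is_derive x 1 (fun t => t / sigma) sigma^-1.
  have := is_derive_fctZ sigma^-1 (is_derive_id x (1 : R)).
  by rewrite mulr1; under eq_fun do rewrite mulrC.
by have := is_derive_fct_comp (g := fun t => t / sigma) (df (x / sigma)) dx; rewrite mulrC.
Qed.

Let sE : s / sigma = z. Proof. by rewrite mulrAC divff ?mul1r// gt_eqF. Qed.

Let comb_s : comb m2 m1 p s = comb 1 1 p z.
Proof.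
have := lt0r_neq0 N_gt0; rewrite /comb /coef1 /coef2 /cross => N0.
by field.
Qed.

Let comb2_s : comb m2 m1 u s = 0.
Proof. by rewrite /comb /coef1 /coef2; ring. Qed.

Let comb2_z : comb 1 1 u z = 0. Proof. by rewrite /comb !mul1r. Qed.

Let comb_ode c1 c2 x : comb c1 c2 u x + x * comb c1 (- c2) q x + a * comb c1 c2 p x = 0.
Proof. by rewrite /comb /hermite2; ring. Qed.

(* The equation [y'' + x y' + a y = 0] determines the slope at [x <> 0] from the
   value and the second derivative, so the first derivatives match as well. *)
Let comb1_s : comb m2 (- m1) q s = sigma^-1 * comb 1 (- 1) q z.
Proof.
have := comb_ode m2 m1 s; have := comb_ode 1 1 z.
rewrite comb2_s comb2_z comb_s !add0r => <- /addIr sz.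
by apply: (mulfI (lt0r_neq0 s_gt0)); rewrite sz; field; rewrite gt_eqF.
Qed.

Let combN c1 c2 f x : comb c1 c2 f (- x) = comb c2 c1 f x.
Proof. by rewrite /comb opprK addrC. Qed.

Let comb1N c1 c2 f x : comb c1 (- c2) f (- x) = - comb c2 (- c1) f x.
Proof. by rewrite /comb opprK; ring. Qed.

Let NsE : - s < s. Proof. by rewrite gtrN. Qed.

(** The inner conditional is glued at s, the outer one at -s, where the matching conditions follow
    from those at s by reflection. *)
Lemma is_derive_glued (x : R) : is_derive x 1 glued (glued1 x).
Proof.
apply: (is_derive_if (c := - s)
  (g' := fun x => if x < s then sigma^-1 * comb 1 (- 1) q (x / sigma)
                  else comb m2 (- m1) q x)).
- exact: near_le_cst.
- exact: dcomb.
- apply: (is_derive_if (c := s)).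
  + exact: near_lt_cst.
  + exact/dscale/dcomb.
  + exact: dcomb.
  + by rewrite sE comb_s.
  + by rewrite sE comb1_s.
- by rewrite NsE mulNr sE !combN comb_s.
- by rewrite NsE mulNr sE !comb1N comb1_s mulrN.
Qed.

Lemma is_derive_glued1 (x : R) : is_derive x 1 glued1 (glued2 x).
Proof.
apply: (is_derive_if (c := - s)
  (g' := fun x => if x < s then sigma^-1 ^+ 2 * comb 1 1 u (x / sigma)
                  else comb m2 m1 u x)).
- exact: near_le_cst.
- by move=> t; have := dcomb m1 (- m2) dq t; rewrite opprK.
- apply: (is_derive_if (c := s)).
  + exact: near_lt_cst.
  + move=> t; have := is_derive_fctZ sigma^-1 (dscale (dcomb 1 (- 1) dq) t).
    by rewrite opprK expr2 mulrA.
  + by move=> t; have := dcomb m2 (- m1) dq t; rewrite opprK.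
  + by rewrite sE comb1_s.
  + by rewrite sE comb2_s comb2_z mulr0.
- by rewrite NsE mulNr sE !comb1N comb1_s mulrN.
- by rewrite NsE mulNr sE !combN comb2_s comb2_z mulr0.
Qed.

Let ccomb c1 c2 : continuous (comb c1 c2 u).
Proof. by move=> x; exact: is_derive_continuous (dcomb c1 c2 du x). Qed.

Lemma continuous_glued2 : continuous glued2.
Proof.
apply: (continuous_if (c := - s)).
- exact: near_le_cst.
- exact: ccomb.
- apply: (continuous_if (c := s)).
  + exact: near_lt_cst.
  + move=> x.
    exact: is_derive_continuous (is_derive_fctZ _ (dscale (dcomb 1 1 du) x)).
  + exact: ccomb.
  + by rewrite sE comb2_s comb2_z mulr0.
- by rewrite NsE mulNr sE !combN comb2_s comb2_z mulr0.
Qed.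

(** Up to a positive factor this is the difference of the two sides of [hermite2_cross]; it makes
    the outer branches convex. *)
Let comb2_ge0 x : s <= x -> 0 <= comb m2 m1 u x.
Proof.
move=> sx; have sx' : 0 <= s <= x by rewrite (ltW s_gt0).
have h := hermite2_cross a_gt0 p_gt0 dp dq q_gt0 sx' us_ge0 us_lt0.
rewrite (_ : comb m2 m1 u x = (p (- z) + p z) / N * (u (- s) * u x - u s * u (- x))).
  by rewrite mulr_ge0 ?subr_ge0// divr_ge0 ?ltW// addr_gt0.
by rewrite /comb /coef1 /coef2; ring.
Qed.

(** On the outer branches y'' >= 0 and the equation is the linear one. In the middle y'' <= 0, and
    with x = sigma v the terms sigma^2 y'' and x y' become h''(v) and v h'(v), giving the linear
    equation at v. *)
Lemma glued_ode x :
  Num.max (glued2 x) 0 - sigma ^+ 2 * Num.max (- glued2 x) 0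
  + x * glued1 x + a * glued x = 0.
Proof.
have sigma_neq0 := lt0r_neq0 sigma_gt0.
have ge0_case f1 f2 f0 y : 0 <= f2 -> f2 + y * f1 + a * f0 = 0 ->
    Num.max f2 0 - sigma ^+ 2 * Num.max (- f2) 0 + y * f1 + a * f0 = 0.
  move=> f2_ge0; rewrite (max_idPl f2_ge0) (max_idPr _) ?oppr_le0//.
  by rewrite mulr0 subr0.
rewrite /glued /glued1 /glued2; case: (leP x (- s)) => [xs|sx]; last case: (ltP x s) => [xs|{}sx].
- apply: ge0_case; last exact: comb_ode.
  by rewrite -combN comb2_ge0// lerNr.
- set v := x / sigma; have -> : x = sigma * v by rewrite /v mulrC divfK.
  have f2_le0 : comb 1 1 u v <= 0.
    have /andP[vN vs] : - z <= v <= z.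
      by rewrite ler_pdivlMr// ler_pdivrMr// mulNr ![_ * sigma]mulrC !ltW.
    rewrite /comb !mul1r; have [v0|v0] := leP 0 v.
      by rewrite even_le0// v0.
    by rewrite addrC -{2}(opprK v) even_le0// oppr_ge0 (ltW v0) lerNl.
  have c_le0 : sigma^-1 ^+ 2 * comb 1 1 u v <= 0.
    by rewrite mulr_ge0_le0// exprn_ge0// invr_ge0 ltW.
  rewrite (max_idPr c_le0) (max_idPl _) ?oppr_ge0//.
  by rewrite -[RHS](comb_ode 1 1 v); field.
- by apply: ge0_case; [exact: comb2_ge0|exact: comb_ode].
Qed.

End piecewise_solution.

(** * Properties of the chosen zeros, and assembly *)

Lemma x1P (R : realType) (lambda : R) : 0 < lambda -> lambda < 1 / 2 ->
  x1 lambda < 0 /\ (phi lambda)^`(2) (x1 lambda) = 0.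
Proof.
(* Nonemptiness makes [xget] return an element of the set instead of the default 0. *)
move=> l0 l1; apply: (@xgetPex _ 0 [set x : R | x < 0 /\ (phi lambda)^`(2) x = 0]).
have [x [x0 ux]] := hermite2_zero (mulr_gt0 (ltr0Sn R 1) l0) (phi_gt0 l0 l1)
  (is_derive_phi l0 l1) (is_derive_phi1 l0 l1) (phi_derive2N1_gt0 l0 l1).
by exists x; split=> //; rewrite phi_derive2E.
Qed.

Lemma zP (R : realType) (lambda : R) : 0 < lambda -> lambda < 1 / 2 ->
  0 < z lambda /\
  (phi lambda)^`(2) (z lambda) + (phi lambda)^`(2) (- z lambda) = 0.
Proof.
move=> l0 l1.
apply: (@xgetPex _ 0
  [set x : R | 0 < x /\ (phi lambda)^`(2) x + (phi lambda)^`(2) (- x) = 0]).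
have [x [x0 ux]] := even_hermite2_zero (mulr_gt0 (ltr0Sn R 1) l0) (phi_gt0 l0 l1)
  (is_derive_phi l0 l1) (is_derive_phi1 l0 l1).
by exists x; split=> //; rewrite !phi_derive2E.
Qed.

Theorem theorem3p5 (R : realType) (lambda sigma : R)
    (lambda_gt0 : 0 < lambda) (lambda_lt : lambda < 1 / 2)
    (sigma_ge : sigma_low lambda <= sigma) (sigma_lt1 : sigma < 1) :
  [/\ 0 < mu1 lambda sigma,
      0 <= mu2 lambda sigma,
      forall x : R, 0 < H lambda sigma x,
      C2 (H lambda sigma)
    & ode_solution lambda sigma (H lambda sigma)].
Proof.
have a_gt0 : 0 < 2 * lambda by rewrite mulr_gt0.
have p_gt0 := phi_gt0 lambda_gt0 lambda_lt.
have dp := is_derive_phi lambda_gt0 lambda_lt.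
have dq := is_derive_phi1 lambda_gt0 lambda_lt.
have q_gt0 := phi_derive1_gt0 lambda_gt0 lambda_lt.
have p2E x := phi_derive2E lambda_gt0 lambda_lt x.
have [x1_lt0] := x1P lambda_gt0 lambda_lt; rewrite p2E => ux1.
have [z_gt0] := zP lambda_gt0 lambda_lt; rewrite !p2E => uz.
have x1s : - x1 lambda <= sigma * z lambda by move: sigma_ge; rewrite ler_pdivrMr.
have sigma_gt0 : 0 < sigma.
  by rewrite -(pmulr_lgt0 _ z_gt0) (lt_le_trans _ x1s)// oppr_gt0.
have us_ge0 : 0 <= hermite2 (2 * lambda) (phi lambda) (phi lambda)^`() (- (sigma * z lambda)).
  by apply: (hermite2_ge0 a_gt0 dp dq q_gt0 _ (ltW x1_lt0) ux1); rewrite lerNl.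
pose K := glued (2 * lambda) sigma (z lambda) (phi lambda) (phi lambda)^`().
pose K1 := glued1 (2 * lambda) sigma (z lambda) (phi lambda) (phi lambda)^`().
pose K2 := glued2 (2 * lambda) sigma (z lambda) (phi lambda) (phi lambda)^`().
have mu1E : mu1 lambda sigma =
    coef1 (2 * lambda) sigma (z lambda) (phi lambda) (phi lambda)^`().
  rewrite /mu1 !p2E /coef1 /cross.
  (* The denominator of [mu1] is the opposite of [cross]; the sign moves to the numerator. *)
  by rewrite -[X in _ / X = _]opprB invrN mulrN !mulNr.
have mu2E : mu2 lambda sigma =
    coef2 (2 * lambda) sigma (z lambda) (phi lambda) (phi lambda)^`().
  by rewrite /mu2 !p2E /coef2 /cross.
have HE : H lambda sigma = K.
  by apply/funext => x; rewrite /H /K /glued /comb mu1E mu2E !mul1r.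
have dK (x : R) : is_derive x 1 K (K1 x).
  exact: is_derive_glued.
have dK1 (x : R) : is_derive x 1 K1 (K2 x).
  exact: is_derive_glued1.
have K1E : K^`() = K1.
  by apply/funext => x; rewrite derive1E; have [] := dK x.
have K2E : K^`(2) = K2.
  by apply/funext => x; rewrite [LHS]derive1E K1E; have [] := dK1 x.
rewrite HE mu1E mu2E; split.
- exact: coef1_gt0.
- exact: coef2_ge0.
- exact: glued_gt0.
- split=> [x|x|]; [by have [] := dK x|by rewrite K1E; have [] := dK1 x|].
  by rewrite K2E; exact: continuous_glued2.
- by move=> x; rewrite K1E K2E; exact: glued_ode.
Qed.
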